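(* Let $(\theta_n)_{n\ge0}$ be a sequence of positive integers such that for some $q>1$ one has $\theta_{n+1}/\theta_n\ge q$ for all $n\ge0$. Let $\varepsilon\in(0,1)$, $f(z)=\sum_{n=0}^{+\infty}e^{n^{\varepsilon}}z^n$ $(|z|<1)$, $h(r)=(1-r)^{-1}$, and for $t\in\mathbb{R}$ put $f_t(z)=\sum_{n=0}^{+\infty}e^{n^\varepsilon}e^{i\theta_nt}z^n$. Then there exists a constant $C=C(\theta,\varepsilon)>0$ (depending only on the sequence $(\theta_n)$ and on $\varepsilon$) such that for every sequence $(r_n)_{n\ge0}$ in $(0,1)$ increasing to $1$ the set $$F_3=\left\{t\in\mathbb{R}:\ \varlimsup_{n\to+\infty}\frac{M_{f_t}(r_n)}{h(r_n)\,\mu_f(r_n)\,\ln^{1/2}\{h(r_n)\mu_f(r_n)\}}\le C\right\}$$ is a set of the first Baire category in $\mathbb{R}$.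
   Context: For a power series $g(z)=\sum_{n\ge0} b_nz^n$ analytic in the unit disc and $r\in(0,1)$: $M_g(r)=\max\{|g(z)|:|z|=r\}$ and $\mu_g(r)=\max\{|b_n|r^n:n\ge0\}$. $\ln^{1/2}x=(\ln x)^{1/2}$. *)

(* Defs.v *)
From mathcomp Require Import all_boot all_order all_algebra.
From mathcomp Require Import complex.
From mathcomp Require Import all_classical all_reals all_analysis.

Set Implicit Arguments.
Unset Strict Implicit.
Unset Printing Implicit Defensive.

Import Order.TTheory GRing.Theory Num.Theory.
Import numFieldNormedType.Exports.

Local Open Scope classical_set_scope.
Local Open Scope ring_scope.
Local Open Scope complex_scope.

Definition nowhere_dense (T : topologicalType) (A : set T) : Prop :=
  interior (closure A) = set0.

Definition first_category (T : topologicalType) (A : set T) : Prop :=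
  exists2 F : (set T)^nat, (forall n, nowhere_dense (F n)) &
    A = \bigcup_n F n.

(* The modulus |z| as an element of R; the library norm `|z| lives in R[i]. *)
Definition modulus (R : realType) (z : R[i]) : R := Normc.normc z.

Definition expi (R : realType) (x : R) : R[i] := cos x +i* sin x.

(* R[i]^o carries the topology of the complex modulus. The limit is meaningful
   only where the series converges; elsewhere limn is an unspecified value. *)
Definition power_series (R : realType) (b : nat -> R[i]) (z : R[i]) : R[i] :=
  limn (series (fun n => b n * z ^+ n : R[i]^o)).

(* For g analytic in the unit disc and 0 < r < 1 the two suprema below are
   attained, so they are the maxima of |g(z)| over |z| = r and of |b_n| r^n
   over n, where g(z) = \sum_n b_n z^n. *)
Definition max_modulus (R : realType) (g : R[i] -> R[i]) (r : R) : R :=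
  sup [set modulus (g z) | z in [set z : R[i] | modulus z = r]].

Definition max_term (R : realType) (b : nat -> R[i]) (r : R) : R :=
  sup (range (fun n : nat => modulus (b n) * r ^+ n)).

Definition f_coef (R : realType) (eps : R) (n : nat) : R[i] :=
  (expR (n%:R `^ eps))%:C.

Definition ft_coef (R : realType) (theta : nat -> nat) (eps t : R) (n : nat) :
    R[i] :=
  f_coef eps n * expi ((theta n)%:R * t).

Definition f_t (R : realType) (theta : nat -> nat) (eps t : R) : R[i] -> R[i] :=
  power_series (ft_coef theta eps t).

Definition h (R : realType) (r : R) : R := (1 - r)^-1.

(* Main.v *)
Require Import Defs.
From mathcomp Require Import all_boot all_order all_algebra.
From mathcomp Require Import complex.
From mathcomp Require Import all_classical all_reals all_analysis.
From mathcomp Require Import zify ring lra.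

Import Order.TTheory GRing.Theory Num.Theory.
Import numFieldNormedType.Exports.

Local Open Scope classical_set_scope.
Local Open Scope ring_scope.

(* Evaluating at the real point [z = r] bounds the maximum modulus from below
   by [Re f_t(r)], the sum of the [e^(n^eps) r^n cos (theta_n t)]. A lacunary
   sequence is a Sidon set, even locally: in every interval some [t] makes this
   sum, once finitely many terms are dropped, at least a constant (depending
   only on [theta]) times the sum of its coefficients. To see this, keep the
   residue class of indices modulo a large [K] that carries the most mass and
   average against the Riesz product over that class times
   [(1 + cos (t - t0))^d], which concentrates near [t0]. Laplace's method at the
   saddle point [x], where [eps x^(eps - 1) = - ln r], shows that the
   coefficients indexed by [[x, x + x^(1 - eps/2)]] alone sum to at least a
   constant times [h mu sqrt (ln (h mu))]. Hence for every [k] the set of [t]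
   whose ratio stays below a small constant from rank [k] on is nowhere
   dense. *)

Set Implicit Arguments.
Unset Strict Implicit.
Unset Printing Implicit Defensive.

(** * Riesz products and their means over equally spaced grids *)

Section RieszProducts.
Variable R : realType.
Implicit Types (m : int) (l : seq (nat * R)) (t tau phi : R).

Lemma sinDint2pi m t : sin (t + m%:~R * (2 * pi)) = sin t.
Proof.
have per n : forall a : R, sin (a + n%:R * (2 * pi)) = sin a.
  move=> a; rewrite (_ : n%:R * _ = (pi *+ 2) *+ n); last by ring.
  exact: periodicn (@sinD2pi R) n a.
case: m => n; first exact: per.
rewrite NegzE mulrNz mulNr; set y := _ * _.
by rewrite -[LHS](per n.+1) subrK.
Qed.

Lemma cos_lt1 t : 0 < t < 2 * pi -> cos t < 1.
Proof.
move=> t02; have s0 : 0 < sin (t / 2) by apply: sin_gt0_pi; lra.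
rewrite (_ : t = (t / 2) *+ 2); last by field.
by rewrite cos_mulr2n cos2sin2; nra.
Qed.

Definition gridpt (M : nat) tau (j : nat) : R := tau + (2 * pi) * j%:R / M%:R.

(** Replaces the integral mean over a period: it is exact for trigonometric polynomials of degree
    below [M]. *)
Definition gridmean (M : nat) tau (F : R -> R) : R :=
  (\sum_(0 <= j < M) F (gridpt M tau j)) / M%:R.

Lemma eq_gridmean M tau F G : F =1 G -> gridmean M tau F = gridmean M tau G.
Proof. by move=> FG; congr (_ / _); apply: eq_bigr => j _. Qed.

Lemma gridmeanD M tau F G :
  gridmean M tau (fun t => F t + G t) = gridmean M tau F + gridmean M tau G.
Proof. by rewrite /gridmean big_split /= mulrDl. Qed.

Lemma gridmeanZ M tau c F :
  gridmean M tau (fun t => c * F t) = c * gridmean M tau F.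
Proof. by rewrite /gridmean -mulr_sumr mulrA. Qed.

Lemma gridmean_sum M tau (a b : nat) (F : nat -> R -> R) :
  gridmean M tau (fun t => \sum_(a <= n < b) F n t) =
  \sum_(a <= n < b) gridmean M tau (F n).
Proof. by rewrite /gridmean exchange_big /= mulr_suml. Qed.

Lemma le_gridmean M tau F G :
  (forall j, (j < M)%N -> F (gridpt M tau j) <= G (gridpt M tau j)) ->
  gridmean M tau F <= gridmean M tau G.
Proof.
move=> FG; rewrite ler_wpM2r ?invr_ge0//.
by rewrite big_nat [leRHS]big_nat; apply: ler_sum => j /andP[_ /FG].
Qed.

(* Summing over the grid telescopes once multiplied by 2 sin (pi m / M). *)
Lemma gridmean_cos M tau m phi : (`|m| < M)%N ->
  gridmean M tau (fun t => cos (m%:~R * t + phi)) =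
  if m == 0 then cos phi else 0.
Proof.
move=> mM; have M0 : (0 : R) < M%:R by rewrite ltr0n; lia.
case: eqP => [->|/eqP m0].
  rewrite (@eq_gridmean _ _ _ (fun=> cos phi)) => [|t]; last by rewrite mul0r add0r.
  rewrite /gridmean sumr_const_nat subn0 -[X in X / _]mulr_natr mulfK ?gt_eqF//.
pose x : R := m%:~R * (2 * pi) / M%:R; pose al := m%:~R * tau + phi.
have sx0 : sin (x / 2) != 0.
  have y0 : 0 < `|m|%N%:R * @pi R / M%:R < pi.
    apply/andP; split; first by rewrite divr_gt0 ?mulr_gt0
         ?(pi_gt0 R) ?M0 ?ltr0n ?absz_gt0.
    by rewrite ltr_pdivrMr// mulrC ltr_pM2l ?(pi_gt0 R)// ltr_nat.
  have := sin_gt0_pi y0.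
  have [m_ge0|m_lt0] := leP 0 m.
    have -> : x / 2 = `|m|%N%:R * pi / M%:R; last by move/gt_eqF ->.
    rewrite /x -[in LHS](gez0_abs m_ge0) -pmulrn.
    by field; rewrite gt_eqF.
  have -> : x / 2 = - (`|m|%N%:R * pi / M%:R).
    have mE : m%:~R = - `|m|%N%:R :> R by rewrite -{1}[m]opprK mulrNz -ltz0_abs.
    by rewrite /x mE; field; rewrite gt_eqF.
  by rewrite sinN oppr_eq0 => /gt_eqF ->.
rewrite /gridmean.
suff : 2 * sin (x / 2) * \sum_(0 <= j < M) cos (m%:~R * gridpt M tau j + phi) = 0.
  by move/eqP; rewrite !mulf_eq0 pnatr_eq0/= (negbTE sx0) /= => /eqP ->; rewrite mul0r.
rewrite mulr_sumr.
rewrite (eq_bigr (fun j : nat => sin (al + x * j.+1%:R - x / 2)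
                                 - sin (al + x * j%:R - x / 2))); last first.
  move=> j _.
  have -> : m%:~R * gridpt M tau j + phi = al + x * j%:R.
    by rewrite /gridpt /x /al; field; rewrite gt_eqF.
  have -> : al + x * j.+1%:R - x / 2 = (al + x * j%:R) + x / 2.
    by rewrite -natr1; field.
  by rewrite [sin (_ + x / 2)]sinD [sin (_ - x / 2)]sinB; ring.
rewrite telescope_sumr ?leq0n//.
have -> : al + x * M%:R - x / 2 = (al + x * 0%:R - x / 2) + m%:~R * (2 * pi).
  by rewrite /x; field; rewrite gt_eqF.
by rewrite sinDint2pi subrr.
Qed.

(** Riesz product over a list of pairs (frequency, phase). Repetitions are allowed, so a power of
    [1 + cos (t - t0)] is also of this form. *)
Fixpoint rprod l t : R :=
  if l is p :: l' then (1 + cos (p.1%:R * t + p.2)) * rprod l' t else 1.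

Lemma rprod_ge0 l t : 0 <= rprod l t.
Proof.
by elim: l => //= p l IH; apply: mulr_ge0 => //; rewrite -lerBlDl sub0r cos_geN1.
Qed.

(* The mean over a period of [cos (m t + phi) * rprod l t], computed by turning
   products of cosines into sums. *)
Fixpoint rmean m phi l : R :=
  if l is p :: l' then
    rmean m phi l' + (rmean (m + p.1%:Z) (phi + p.2) l'
                      + rmean (m - p.1%:Z) (phi - p.2) l') / 2
  else if m == 0 then cos phi else 0.

(** A bound for the degree of the trigonometric polynomial [rprod l]. *)
Definition weight l : nat := sumn [seq p.1 | p <- l].

(** Expanding one factor by the product formula for cosines shifts [m] by at most its frequency, so
    the degree bound survives the induction. *)
Lemma gridmean_rprod l M tau m phi : (`|m| + weight l < M)%N ->
  gridmean M tau (fun t => cos (m%:~R * t + phi) * rprod l t) = rmean m phi l.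
Proof.
elim: l m phi => [|[b psi] l IH] m phi.
  rewrite /weight /= addn0 => mM; rewrite -(gridmean_cos tau phi mM).
  by apply: eq_gridmean => t; rewrite mulr1.
rewrite /weight /= -/(weight l) => mM.
rewrite -!IH; [|lia..].
rewrite -gridmeanD [X in _ + X]mulrC -gridmeanZ -gridmeanD.
apply: eq_gridmean => t /=.
have -> : (m + b%:Z)%:~R * t + (phi + psi) =
  (m%:~R * t + phi) + (b%:R * t + psi) by rewrite intrD; ring.
have -> : (m - b%:Z)%:~R * t + (phi - psi) =
  (m%:~R * t + phi) - (b%:R * t + psi) by rewrite intrB; ring.
rewrite [cos (_ + (_ + psi))]cosD [cos (_ - (_ + psi))]cosB.
by field.
Qed.

(** The frequencies of [rprod l] lie between [- weight l] and [weight l], so none of them can cancel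
    [m]. *)
Lemma rmean_eq0 l m phi : (weight l < `|m|)%N -> rmean m phi l = 0.
Proof.
elim: l m phi => [|[b psi] l IH] m phi /=.
  by rewrite /weight /=; case: eqP => // ->.
rewrite /weight /= -/(weight l) => lm.
by rewrite !IH ?addr0 ?mul0r ?addr0//; lia.
Qed.

(* Two grids compute the same mean, and a grid of [d + 1] points can be chosen
   to contain a point where the product is [2 ^ d]. *)
Lemma rmean_nseq1_ge (d : nat) phi :
  2 ^+ d / d.+1%:R <= rmean 0 0 (nseq d (1%N, - phi)).
Proof.
have wd : weight (nseq d (1%N, - phi)) = d.
  by rewrite /weight map_nseq sumn_nseq mul1n.
rewrite -(@gridmean_rprod _ d.+1 phi); last by rewrite wd /=.
rewrite ler_wpM2r ?invr_ge0// big_nat_recl//.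
rewrite ler_wpDr//.
  by apply: sumr_ge0 => j _; rewrite mul0r add0r cos0 mul1r rprod_ge0.
rewrite /gridpt mulr0 mul0r !addr0 mul0r cos0 mul1r.
elim: (d) => [|k IH] //=.
rewrite mul1r subrr cos0 exprS; apply: ler_pM => //.
Qed.

End RieszProducts.

(** * Means of Riesz products with rapidly growing frequencies *)

Section DissociateMeans.
Variable R : realType.
Variables (lam : nat -> nat) (l0 : seq (nat * R)).

Fixpoint riesz_list (k : nat) : seq (nat * R) :=
  if k is k'.+1 then (lam k', 0) :: riesz_list k' else l0.

Lemma weight_riesz_listS k :
  weight (riesz_list k.+1) = (lam k + weight (riesz_list k))%N.
Proof. by []. Qed.

Lemma rprod_riesz_list k t : rprod (riesz_list k) t =
  \prod_(i < k) (1 + cos ((lam i)%:R * t)) * rprod l0 t.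
Proof.
elim: k => [|k IH]; first by rewrite big_ord0 mul1r.
by rewrite big_ord_recr /= IH addr0 mulrA [_ * \prod_(_ < _) _]mulrC.
Qed.

(** A factor whose frequency exceeds [|m|] plus the weight of all earlier factors moves [m] out of
    their range, so only its constant term contributes. *)
Lemma rmean_riesz_list_low (m : int) phi k0 k : (k0 <= k)%N ->
  (forall v, (k0 <= v < k)%N -> (`|m| + weight (riesz_list v) < lam v)%N) ->
  rmean m phi (riesz_list k) = rmean m phi (riesz_list k0).
Proof.
elim: k => [|k IH]; first by case: k0.
rewrite leq_eqVlt => /orP[/eqP -> //|k0k] H.
rewrite /= -IH//; last by move=> v v_in; apply: H; lia.
have := H k; rewrite -ltnS k0k ltnSn => /(_ isT) Hk.
rewrite [rmean (m + _) _ _]rmean_eq0 ?[rmean (m - _) _ _]rmean_eq0; [|lia..].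
by rewrite addr0 mul0r addr0.
Qed.

Lemma rmean_riesz_list_gap (m : int) phi k0 k : (k0 <= k)%N ->
  (weight (riesz_list k0) < `|m|)%N ->
  (forall v, (k0 <= v < k)%N -> (`|m| + weight (riesz_list v) < lam v)%N) ->
  rmean m phi (riesz_list k) = 0.
Proof. by move=> k0k wm H; rewrite (rmean_riesz_list_low _ k0k)// rmean_eq0. Qed.

(** Of the three frequencies [lam k0], [2 lam k0] and [0] produced by factor [k0], only [0] lies
    within the weight of the earlier factors; it carries the coefficient 1/2. *)
Lemma rmean_riesz_list_at phi k0 k : (k0 < k)%N ->
  (forall v, (v < k)%N -> (weight (riesz_list v) < lam v)%N) ->
  (forall v, (k0 < v < k)%N ->
    (lam k0 + weight (riesz_list v) < lam v)%N) ->
  rmean (lam k0) phi (riesz_list k) = rmean 0 phi l0 / 2.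
Proof.
move=> k0k H1 H2; have Hk0 := H1 _ k0k.
rewrite (rmean_riesz_list_low _ k0k)// /= !subr0 subrr addr0.
rewrite [rmean (Posz _) _ _]rmean_eq0 ?[rmean (_ + _) _ _]rmean_eq0 ?add0r; [|lia..].
rewrite (@rmean_riesz_list_low 0 _ 0)// => v /andP[_ vk].
by rewrite absz0 add0n H1// (ltn_trans vk).
Qed.

Lemma rmean0_riesz_list phi k :
  (forall v, (v < k)%N -> (weight (riesz_list v) < lam v)%N) ->
  rmean 0 phi (riesz_list k) = rmean 0 phi l0.
Proof. by move=> H; rewrite (@rmean_riesz_list_low 0 _ 0)// => v /H. Qed.

End DissociateMeans.

(** * Fourier coefficients of the Riesz product over a residue class of indices *)

Section LacunarySequences.
Variable R : realType.
Variables (theta : nat -> nat) (gam : R) (K u0 d j : nat).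
Hypotheses (gam_gt0 : 0 < gam) (gam_lt1 : gam < 1).
Hypothesis theta_lt : forall n m, (n < m)%N ->
  (theta n)%:R <= (1 - gam) * (theta m)%:R.
Hypothesis theta_K : forall n, (theta n)%:R <= gam / 4 * (theta (n + K)%N)%:R.
Hypothesis theta_large : forall n, (u0 * K <= n)%N ->
  2 * d%:R < gam * (theta n)%:R.
Hypothesis jK : (j < K)%N.
Variable l0 : seq (nat * R).
Hypothesis weight_l0 : weight l0 = d.

Let lam (u : nat) := theta ((u0 + u) * K + j)%N.

(** Inductive step: [(1 + gam / 2) lam k <= 2 lam k <= gam / 2 * lam k.+1], since one step within
    the class multiplies [theta] by at least [4 / gam]. *)
Lemma weight_class k :
  (weight (riesz_list lam l0 k))%:R <= d%:R + gam / 2 * (lam k)%:R.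
Proof.
elim: k => [|k IH].
  rewrite /= weight_l0; have := ler0n R (lam 0); move: gam_gt0 gam_lt1; nra.
rewrite weight_riesz_listS natrD.
have := theta_K ((u0 + k) * K + j)%N.
rewrite -/(lam k) (_ : ((u0 + k) * K + j + K)%N = ((u0 + k.+1) * K + j)%N); last by lia.
rewrite -/(lam k.+1).
have : (0 : R) <= (lam k)%:R by [].
by move: gam_gt0 gam_lt1; nra.
Qed.

Lemma lam_large k : 2 * d%:R < gam * (lam k)%:R.
Proof. by apply: theta_large; lia. Qed.

Lemma weight_class_lt k : (weight (riesz_list lam l0 k) < lam k)%N.
Proof.
rewrite -(ltr_nat R); apply: le_lt_trans (weight_class k) _.
have := lam_large k; have := ler0n R (lam k); move: gam_gt0 gam_lt1; nra.
Qed.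

(** The gap [gam * lam k] between [theta n] and [lam k] absorbs both halves of the weight: [d] and
    [gam / 2 * lam k]. *)
Lemma weight_class_below n k : (u0 * K <= n)%N -> (n < (u0 + k) * K + j)%N ->
  (theta n + weight (riesz_list lam l0 k) < lam k)%N.
Proof.
move=> un nk; rewrite -(ltr_nat R) natrD.
have := weight_class k; have := lam_large k; have := theta_lt nk.
by rewrite -/(lam k); move: gam_gt0 gam_lt1; nra.
Qed.

Lemma weight_class_above n k : (u0 * K <= n)%N ->
  (forall v, (v < k)%N -> ((u0 + v) * K + j < n)%N) ->
  (weight (riesz_list lam l0 k) < theta n)%N.
Proof.
move=> un H; rewrite -(ltr_nat R).
have dn := theta_large un; have n0 : (0 : R) <= (theta n)%:R by [].
case: k H => [|k] H; first by rewrite /= weight_l0; move: gam_gt0 gam_lt1; nra.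
rewrite weight_riesz_listS natrD.
have := weight_class k; have := theta_lt (H _ (ltnSn k)).
rewrite -/(lam k); have : (0 : R) <= (lam k)%:R by [].
by move: gam_gt0 gam_lt1; nra.
Qed.

(** This makes the product test the coefficients of one class only: frequencies of the other classes
    are orthogonal to it. *)
Lemma rmean_class n k : (u0 * K <= n)%N -> (n < (u0 + k) * K)%N ->
  rmean (theta n) 0 (riesz_list lam l0 k) =
  if (n %% K == j)%N then rmean 0 0 l0 / 2 else 0.
Proof.
move=> un nk; have K0 : (0 < K)%N by lia.
have [u [i [iK nE]]] : exists u i, (i < K)%N /\ n = ((u0 + u) * K + i)%N.
  exists (n %/ K - u0)%N, (n %% K)%N; rewrite ltn_mod; split=> //.
  by rewrite subnKC ?leq_divRL// -divn_eq.
rewrite {}nE in un nk *.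
have -> : (((u0 + u) * K + i) %% K = i)%N by rewrite modnMDl modn_small.
have le_mulK v w : (v <= w)%N -> ((u0 + v) * K <= (u0 + w) * K)%N.
  by move=> vw; rewrite leq_mul2r leq_add2l vw orbT.
have lt_mulK v w : (v < w)%N -> ((u0 + v) * K + K <= (u0 + w) * K)%N.
  by move=> vw; rewrite addnC -mulSn -addnS le_mulK.
have uk : (u < k)%N.
  rewrite ltnNge; apply/negP => /le_mulK; lia.
(* An index with residue below [j] falls just before member [u] of the class, one with residue above
   [j] just after it; this fixes where the product is cut. *)
have [ij|ji|ij] := ltngtP i j.
- apply: (@rmean_riesz_list_gap _ _ _ _ _ u); first exact: ltnW.
    by apply: weight_class_above => // v /lt_mulK; lia.
  by move=> v /andP[/le_mulK uv _]; apply: weight_class_below => //; lia.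
- apply: (@rmean_riesz_list_gap _ _ _ _ _ u.+1) => //.
    apply: weight_class_above => // v; rewrite ltnS => /le_mulK; lia.
  by move=> v /andP[/lt_mulK uv _]; apply: weight_class_below => //; lia.
- rewrite ij; apply: rmean_riesz_list_at => // v; first by rewrite weight_class_lt.
  by move=> /andP[/lt_mulK uv _]; apply: weight_class_below => //; lia.
Qed.

End LacunarySequences.

(** * The local Sidon property of lacunary sequences *)

Section LocalSidon.
Variable R : realType.

Lemma ler_cos_dist (t0 t eta : R) : 0 <= eta <= pi -> eta <= `|t - t0| <= pi ->
  cos (t - t0) <= cos eta.
Proof.
move=> /andP[e0 epi] /andP[et tpi]; rewrite -cos_norm.
move: et; rewrite le_eqVlt => /orP[/eqP -> //|et]; apply/ltW.
by rewrite ltr_cos// in_itv/= ?e0 ?epi ?normr_ge0.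
Qed.

(** With [y] the square root of [x], the geometric sum bounds [d.+1%:R * y ^+ d] by [(1 - y)^-1],
    and the remaining factor [y ^+ d] tends to 0. *)
Lemma exists_exprn_le (x del : R) : 0 <= x < 1 -> 0 < del ->
  exists d : nat, d.+1%:R * x ^+ d <= del.
Proof.
move=> /andP[x0 x1] del0; pose y := Num.sqrt x.
have y0 : 0 <= y by exact: sqrtr_ge0.
have y1 : y < 1 by rewrite -(sqrtr1 R) ltr_sqrt.
have yd d : d.+1%:R * y ^+ d <= (1 - y)^-1.
  rewrite -[leRHS]mul1r ler_pdivlMr ?subr_gt0//.
  apply: (@le_trans _ _ (1 - y ^+ d.+1)); last by rewrite gerBl exprn_ge0.
  have -> : 1 - y ^+ d.+1 = (1 - y) * \sum_(i < d.+1) y ^+ i.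
    by have := subrX1 y d.+1; lra.
  rewrite mulrC ler_pM2l ?subr_gt0//.
  rewrite -[X in X%:R * _](card_ord d.+1) -sum1_card natr_sum mulr_suml.
  apply: ler_sum => i _; rewrite mul1r; apply: ler_wiXn2l => //; first exact: ltW.
  by rewrite -ltnS.
have /cvgrPdist_le /(_ (del * (1 - y))) : (fun n => y ^+ n) @ \oo --> (0 : R).
  by apply: cvg_expr; rewrite ger0_norm.
have dy : 0 < del * (1 - y) by rewrite mulr_gt0 ?subr_gt0.
move=> /(_ dy)[N _ /(_ N (leqnn N))] /=; rewrite sub0r normrN
  ger0_norm ?exprn_ge0// => yN.
exists N; rewrite -(sqr_sqrtr x0) -/y -exprM mulnC exprM expr2 mulrA.
have y1' : 0 < 1 - y by rewrite subr_gt0.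
apply: (@le_trans _ _ ((1 - y)^-1 * (del * (1 - y)))).
  by apply: ler_pM => //; rewrite ?exprn_ge0// mulr_ge0// exprn_ge0.
by rewrite mulrC mulfK ?gt_eqF.
Qed.

(** Pigeonhole: if every class carried less than a share 1/[K] of the mass, the shares would not add
    up. *)
Lemma exists_heavy_class (a : nat -> R) (K m n : nat) : (0 < K)%N ->
  exists2 j, (j < K)%N &
    \sum_(m <= i < n) a i <= K%:R * \sum_(m <= i < n | (i %% K == j)%N) a i.
Proof.
move=> K0; apply: contrapT => H.
have : \sum_(j < K) (K%:R * \sum_(m <= i < n | (i %% K == j)%N) a i) <
       \sum_(j < K) \sum_(m <= i < n) a i.
  apply: ltr_sum => [|j _]; first by apply/hasP;
    exists (Ordinal K0); rewrite ?mem_index_enum.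
  by rewrite ltNge; apply/negP => Hj; apply: H; exists j.
rewrite sumr_const card_ord -mulr_sumr -[ltRHS]mulr_natl ltr_pM2l ?ltr0n//.
rewrite (exchange_big_dep xpredT)//=.
rewrite (eq_bigr a) ?ltxx// => i _.
by rewrite (big_pred1 (Ordinal (ltn_pmod i K0)))// => j; rewrite /= eq_sym.
Qed.

(* If the conclusion failed, comparing [F * W] pointwise with multiples of [W]
   (near [t0]) and of [P] (elsewhere) would bound its mean below its actual
   value, half the mass of the heaviest class times the mean of [rprod l0]. *)
Lemma local_sidon_class (theta : nat -> nat) (gam : R) (K u0 d k : nat)
    (t0 eta : R) (a : nat -> R) :
  0 < gam -> gam < 1 -> (0 < K)%N ->
  (forall n m, (n < m)%N -> (theta n)%:R <= (1 - gam) * (theta m)%:R) ->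
  (forall n, (theta n)%:R <= gam / 4 * (theta (n + K)%N)%:R) ->
  (forall n, (u0 * K <= n)%N -> 2 * d%:R < gam * (theta n)%:R) ->
  0 < eta <= pi ->
  d.+1%:R * ((1 + cos eta) / 2) ^+ d <= (8 * K%:R)^-1 ->
  (forall n, 0 <= a n) ->
  exists2 t, `|t - t0| < eta &
    (8 * K%:R)^-1 * \sum_(u0 * K <= n < (u0 + k) * K) a n <=
    \sum_(u0 * K <= n < (u0 + k) * K) a n * cos ((theta n)%:R * t).
Proof.
move=> gam0 gam1 K0 theta_lt theta_K theta_large /andP[eta0 etapi] d_large a0.
set c := (8 * K%:R)^-1; set A := \sum_(_ <= n < _) a n.
set F := fun t => \sum_(u0 * K <= n < (u0 + k) * K) a n * cos ((theta n)%:R * t).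
apply: contrapT => noF.
have Fc t : `|t - t0| < eta -> F t < c * A.
  by move=> tt0; rewrite ltNge; apply/negP => Ft; apply: noF; exists t.
have A0 : 0 <= A by apply: sumr_ge0.
have FA t : F t <= A.
  by apply: ler_sum => n _; rewrite ler_piMr// cos_le1.
have FNA t : - A <= F t.
  rewrite /A -sumrN; apply: ler_sum => n _.
  by rewrite -mulrN1 ler_wpM2l// cos_geN1.
have c0 : 0 < c by rewrite invr_gt0 mulr_gt0// ltr0n.
have cK : c * K%:R = 8^-1.
  by rewrite /c; field; rewrite pnatr_eq0 -lt0n.
have [j jK Aj] := exists_heavy_class a (u0 * K) ((u0 + k) * K) K0.
rewrite -/A in Aj.
set B := \sum_(_ <= n < _ | _) a n in Aj.
pose lam (u : nat) := theta ((u0 + u) * K + j)%N.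
pose l0 := nseq d (1%N, - t0).
have wl0 : weight l0 = d by rewrite /weight map_nseq sumn_nseq mul1n.
(* [W] is [P] multiplied by the kernel [(1 + cos (t - t0)) ^+ d] peaked at [t0]. *)
pose W := riesz_list lam l0 k; pose P := riesz_list lam (@nil (nat * R)) k.
have rl0 t : rprod l0 t = (1 + cos (t - t0)) ^+ d.
  rewrite /l0; elim: (d) => //= e ->; by rewrite mul1r exprS.
have WP t : rprod W t = rprod P t * (1 + cos (t - t0)) ^+ d.
  by rewrite !rprod_riesz_list rl0 /= mulr1.
pose g := rmean 0 0 l0.
have g_ge : 2 ^+ d / d.+1%:R <= g := rmean_nseq1_ge d t0.
have g0 : 0 < g by apply: lt_le_trans g_ge; rewrite divr_gt0// exprn_gt0.
(* [M] exceeds every degree met below, so all grid means are exact; starting the grid at [t0 - pi]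
   keeps its points within [pi] of [t0]. *)
pose M := (theta ((u0 + k) * K)%N + weight W + weight P).+1.
have M0 : (0 : R) < M%:R by rewrite ltr0n.
pose tau := t0 - pi.
have grid_dist i : (i < M)%N -> `|gridpt M tau i - t0| <= pi.
  move=> iM; have -> : gridpt M tau i - t0 = pi * (2 * (i%:R / M%:R) - 1).
    by rewrite /gridpt /tau; field; rewrite gt_eqF.
  rewrite normrM ger0_norm ?pi_ge0// ler_piMr ?pi_ge0//.
  have : (0 : R) <= i%:R / M%:R by rewrite divr_ge0.
  have : i%:R / M%:R <= (1 : R) by rewrite ler_pdivrMr// mul1r ler_nat ltnW.
  by rewrite ler_norml; lra.
have mean_W : gridmean M tau (rprod W) = g.
  rewrite (@eq_gridmean _ _ _ _
    (fun t => cos ((0 : int)%:~R * t + 0) * rprod W t)); last first.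
    by move=> t; rewrite mul0r add0r cos0 mul1r.
  rewrite gridmean_rprod; last by rewrite absz0; lia.
  apply: rmean0_riesz_list => v _.
  exact: (weight_class_lt gam0 gam1 theta_K theta_large).
have mean_P : gridmean M tau (rprod P) = 1.
  rewrite (@eq_gridmean _ _ _ _
    (fun t => cos ((0 : int)%:~R * t + 0) * rprod P t)); last first.
    by move=> t; rewrite mul0r add0r cos0 mul1r.
  rewrite gridmean_rprod; last by rewrite absz0; lia.
  rewrite rmean0_riesz_list ?cos0 //= ?cos0// => v _.
  apply: (@weight_class_lt _ _ _ _ _ 0 _ gam0 gam1 theta_K) => // n /theta_large.
  by apply: le_lt_trans; rewrite mulr0 mulr_ge0.
have mean_FW : gridmean M tau (fun t => F t * rprod W t) = B * g / 2.
  rewrite (@eq_gridmean _ _ _ _ (fun t => \sum_(u0 * K <= n < (u0 + k) * K)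
     a n * (cos ((theta n)%:Z%:~R * t + 0) * rprod W t))); last first.
    by move=> t; rewrite /F mulr_suml; apply: eq_bigr => n _; rewrite addr0 mulrA.
  rewrite gridmean_sum /B -mulrA mulr_suml.
  rewrite [RHS]big_mkcond /=; apply: eq_big_nat => n /andP[n1 n2].
  rewrite gridmeanZ gridmean_rprod; last first.
    have : (theta n <= theta ((u0 + k) * K)%N)%N.
      rewrite -(ler_nat R); apply: le_trans (theta_lt _ _ n2) _.
      by rewrite ler_piMl//; lra.
    by rewrite absz_nat /M; lia.
  rewrite (rmean_class gam0 gam1 theta_lt theta_K theta_large jK wl0)//.
  by case: ifP => _; rewrite ?mulr0.
have : gridmean M tau (fun t => F t * rprod W t) <=
       gridmean M tau (fun t => c * A * rprod W t + A * (1 + cos eta) ^+ d * rprod P t).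
  apply: le_gridmean => i /grid_dist; set t := gridpt M tau i => tpi.
  have [tt0|tt0] := ltP `|t - t0| eta.
    apply: ler_wpDr; last by rewrite ler_wpM2r ?rprod_ge0// ltW// Fc.
    rewrite mulr_ge0 ?rprod_ge0// mulr_ge0// exprn_ge0//.
  apply: ler_wpDl; first by rewrite mulr_ge0 ?rprod_ge0// mulr_ge0// ltW.
  have X0 : 0 <= 1 + cos (t - t0) by have := cos_geN1 (t - t0); lra.
  rewrite -mulrA; apply: (@le_trans _ _ (A * rprod W t)).
    by rewrite ler_wpM2r ?rprod_ge0.
  rewrite ler_wpM2l// WP mulrC ler_wpM2r ?rprod_ge0//.
  rewrite lerXn2r ?nnegrE//.
  by rewrite lerD2l ler_cos_dist// ?tt0 ?tpi// ltW.
rewrite gridmeanD !gridmeanZ mean_FW mean_W mean_P mulr1 => main.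
(* By the choice of [d], the kernel away from [t0] is at most [c] times its mean. *)
have Eg : (1 + cos eta) ^+ d <= c * g.
  apply: le_trans (ler_wpM2l (ltW c0) g_ge).
  rewrite mulrA ler_pdivlMr ?ltr0n// mulrC -ler_pdivrMr ?exprn_gt0//.
  by rewrite -mulrA -expr_div_n.
have K0' : (0 : R) < K%:R by rewrite ltr0n.
have AE : A * (1 + cos eta) ^+ d <= A * (c * g) by rewrite ler_wpM2l.
(* The comparison gives [B * g / 2 <= 2 * c * A * g]. With [A <= K B] and [c K = 1/8] this forces
   [A <= A / 2]. *)
have BcA : B <= 4 * (c * A).
  rewrite -(ler_pM2r g0); lra.
have : A <= 2^-1 * A.
  apply: le_trans Aj _; apply: le_trans (ler_wpM2l (ltW K0') BcA) _.
  by rewrite (_ : K%:R * _ = 4 * (c * K%:R) * A); [rewrite cK; lra|ring].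
(* Zero mass is excluded as well: it would give [0 <= F t0 < 0]. *)
move=> A_half; have AE0 : A = 0 by lra.
have := Fc t0; have := FNA t0; rewrite AE0 mulr0 oppr0 subrr normr0 => + /(_ eta0).
by move=> /le_lt_trans h1 /h1; rewrite ltxx.
Qed.

(** The order of choices makes [c] independent of the interval: [q] determines [K] and hence [c];
    only then does [eta] determine the kernel degree [d], and [d] the number [u0 * K] of dropped
    terms. *)
Lemma lacunary_local_sidon (theta : nat -> nat) :
  (forall n : nat, (0 < theta n)%N) ->
  (exists q : R, 1 < q /\
     forall n : nat, q <= (theta n.+1)%:R / (theta n)%:R) ->
  exists2 c : R, 0 < c & forall t0 eta, 0 < eta ->
    exists N, forall (a : nat -> R) N', (forall n, 0 <= a n) ->
    exists2 t, `|t - t0| < eta &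
      c * \sum_(N <= n < N') a n <=
      \sum_(N <= n < N') a n * cos ((theta n)%:R * t).
Proof.
move=> theta_gt0 [q [q1 theta_q]].
have q0 : 0 < q by lra.
pose x := q^-1; have x0 : 0 < x by rewrite invr_gt0.
have x1 : x < 1 by rewrite invf_lt1.
have theta0 n : (0 : R) < (theta n)%:R by rewrite ltr0n.
have step n : (theta n)%:R <= x * (theta n.+1)%:R.
  by have := theta_q n; rewrite ler_pdivlMr// -ler_pdivlMl.
have theta_pow n k : (theta n)%:R <= x ^+ k * (theta (n + k)%N)%:R.
  elim: k => [|k IH]; first by rewrite expr0 mul1r addn0.
  rewrite addnS exprSr -mulrA; apply: le_trans IH _.
  by rewrite ler_wpM2l// exprn_ge0 ?ltW.
have theta_lt n m : (n < m)%N -> (theta n)%:R <= x * (theta m)%:R.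
  move=> nm; apply: le_trans (theta_pow n (m - n)%N) _.
  rewrite (subnKC (ltnW nm)); apply: ler_wpM2r; first exact: ltW.
  have mn : (1 <= m - n)%N by lia.
  by have := ler_wiXn2l (ltW x0) (ltW x1) mn; rewrite expr1.
pose gam := 1 - x.
have gam0 : 0 < gam by rewrite /gam; lra.
have gam1 : gam < 1 by rewrite /gam; lra.
have xE : 1 - gam = x by rewrite /gam; lra.
have [K0 K0P] : exists d : nat, d.+1%:R * x ^+ d <= gam / 4.
  by apply: exists_exprn_le; rewrite ?ltW ?x1// divr_gt0.
have [K K_gt0 theta_K] : exists2 K, (0 < K)%N &
    forall n, (theta n)%:R <= gam / 4 * (theta (n + K)%N)%:R.
  exists K0.+1 => // n; apply: le_trans (theta_pow n K0.+1) _.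
  rewrite ler_wpM2r//; apply: le_trans K0P.
  rewrite exprS ler_pM ?exprn_ge0 ?(ltW x0)//.
  by rewrite (le_trans (ltW x1))// ler1n.
have Kp : (0 : R) < K%:R by rewrite ltr0n.
have theta_ge n : (n <= theta n)%N.
  elim: n => // n IH; apply: leq_ltn_trans IH _.
  rewrite -(ltr_nat R); apply: le_lt_trans (step n) _.
  by rewrite gtr_pMl.
exists (8 * K%:R)^-1; first by rewrite invr_gt0 mulr_gt0.
move=> t0 eta eta0; pose eta' := Num.min eta pi.
have eta'0 : 0 < eta' by rewrite lt_min eta0 pi_gt0.
have eta'pi : eta' <= pi by rewrite ge_min lexx orbT.
have [d dP] : exists d : nat,
    d.+1%:R * ((1 + cos eta') / 2) ^+ d <= (8 * K%:R)^-1.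
  apply: exists_exprn_le; last by rewrite invr_gt0 mulr_gt0.
  have := cos_geN1 eta'.
  have : cos eta' < 1 by apply: cos_lt1; have := pi_gt0 R; lra.
  by lra.
have [u0 u0P] : exists u0 : nat, 2 * d%:R < gam * u0%:R.
  exists (Num.bound (2 * d%:R / gam)).
  have /archi_boundP : 0 <= 2 * d%:R / gam by rewrite divr_ge0 ?mulr_ge0// ltW.
  by rewrite ltr_pdivrMr// [_ * gam]mulrC.
exists (u0 * K)%N => a N' a0.
have theta_large n : (u0 * K <= n)%N -> 2 * d%:R < gam * (theta n)%:R.
  move=> un; apply: lt_le_trans u0P _; rewrite ler_pM2l// ler_nat.
  by apply: leq_trans (theta_ge n); nia.
(* Padding by zeros turns the range up to [N'] into a whole number of blocks of length [K]. *)
pose a' n := if (n < N')%N then a n else 0.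
have a'0 n : 0 <= a' n by rewrite /a'; case: ifP.
have [||t tt0] := @local_sidon_class theta gam K u0 d N' t0 eta' a'
  gam0 gam1 K_gt0 _ theta_K theta_large _ dP a'0.
- by rewrite xE.
- by rewrite eta'0.
have a'E (F : nat -> R) : \sum_(u0 * K <= n < (u0 + N') * K) a' n * F n =
    \sum_(u0 * K <= n < N') a n * F n.
  have N'le : (N' <= (u0 + N') * K)%N.
    by rewrite mulnDl (leq_trans (leq_pmulr _ K_gt0))// leq_addl.
  rewrite [RHS](big_nat_widen _ _ _ _ _ N'le).
  rewrite [RHS]big_mkcond /=; apply: eq_bigr => n _.
  by rewrite /a'; case: ifP => _ //; rewrite mul0r.
have := a'E (fun=> 1); under eq_bigr do rewrite mulr1.
under [RHS]eq_bigr do rewrite mulr1.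
rewrite a'E => -> H; exists t => //.
by apply: lt_le_trans tt0 _; rewrite ge_min lexx.
Qed.

End LocalSidon.

(** * Tangent bounds for powers and the terms near the saddle point *)

Section SaddlePoint.
Variable R : realType.
Implicit Types (e x y u : R).

(** Young's inequality for [(1 + u) ^ e] and [1] with conjugate exponents [1/e] and [1/(1 - e)]. *)
Lemma powR_le_bernoulli e u : 0 < e < 1 -> -1 <= u -> (1 + u) `^ e <= 1 + e * u.
Proof.
move=> /andP[e0 e1] u1; have e1' : 0 < 1 - e by lra.
have u0 : 0 <= 1 + u by lra.
have := @conjugate_powR R ((1 + u) `^ e) 1 e^-1 (1 - e)^-1 (powR_ge0 _ _) ler01.
rewrite !invr_gt0 => /(_ e0 e1'); rewrite !invrK => H.
have := H ltac:(lra).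
rewrite mulr1 -powRrM mulfV ?gt_eqF// powRr1// powR1 /=.
by lra.
Qed.

Lemma powR_le_tangent e x y : 0 < e < 1 -> 0 < x -> 0 <= y ->
  y `^ e <= x `^ e + e * x `^ (e - 1) * (y - x).
Proof.
move=> e01 x0 y0; have xe : x `^ e = x * x `^ (e - 1).
  by rewrite mulr_powRB1 ?ltW//; case/andP: e01.
have -> : y `^ e = x `^ e * (1 + (y / x - 1)) `^ e.
  rewrite [1 + _]addrC subrK -powRM ?divr_ge0 ?(ltW x0)//.
  by congr (_ `^ _); field; rewrite gt_eqF.
have H : -1 <= y / x - 1 by rewrite lerBrDr addNr divr_ge0// ltW.
apply: le_trans (ler_wpM2l (powR_ge0 _ _) (powR_le_bernoulli e01 H)) _.
rewrite [in leRHS]mulrAC xe le_eqVlt; apply/orP; left; apply/eqP.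
by field; rewrite gt_eqF.
Qed.

(* Apply Bernoulli's inequality to the denominator of
   [(1 + u)^e = (1 + u) / (1 + u)^(1 - e)]. *)
Lemma powR_ge_bernoulli2 e u : 0 < e < 1 -> 0 <= u ->
  1 + e * u - u ^+ 2 <= (1 + u) `^ e.
Proof.
move=> /andP[e0 e1] u0; have p01 : 0 < 1 - e < 1 by lra.
have u1 : 0 < 1 + u by lra.
have := powR_le_bernoulli p01 (_ : -1 <= u); rewrite powRB ?gt_eqF ?implybT// => H.
have {H} := H ltac:(lra); rewrite powRr1 ?(ltW u1)// ler_pdivrMr ?powR_gt0// => H.
set X := (1 + u) `^ e in H *.
have X0 : 0 < X by rewrite powR_gt0.
have pu : 0 < 1 + (1 - e) * u by nra.
rewrite -(ler_pM2l pu); apply: le_trans H.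
have u20 : 0 <= u ^+ 2 by rewrite sqr_ge0.
have : 0 <= (1 - e) * u * u ^+ 2 by rewrite !mulr_ge0//; lra.
have : 0 <= e * (1 - e) * u ^+ 2 <= u ^+ 2 by apply/andP; split; nra.
have -> : (1 + (1 - e) * u) * (1 + e * u - u ^+ 2) =
  1 + u + e * (1 - e) * u ^+ 2 - u ^+ 2 - (1 - e) * u * u ^+ 2 by ring.
by lra.
Qed.

Lemma powR_ge_tangent2 e x y : 0 < e < 1 -> 0 < x -> 0 <= y ->
  x `^ e + e * x `^ (e - 1) * y - x `^ e * (y / x) ^+ 2 <= (x + y) `^ e.
Proof.
move=> e01 x0 y0; have xe : x `^ e = x * x `^ (e - 1).
  by rewrite mulr_powRB1 ?ltW//; case/andP: e01.
have yx : 0 <= y / x by rewrite divr_ge0// ltW.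
have -> : (x + y) `^ e = x `^ e * (1 + y / x) `^ e.
  rewrite -powRM ?ltW//; last by rewrite ltr_wpDr.
  by congr (_ `^ _); field; rewrite gt_eqF.
apply: le_trans (ler_wpM2l (powR_ge0 _ _) (powR_ge_bernoulli2 e01 yx)).
rewrite xe le_eqVlt; apply/orP; left; apply/eqP.
by field; rewrite gt_eqF.
Qed.

Definition f_term e r (n : nat) : R := expR (n%:R `^ e) * r ^+ n.

(** Solves [e x^(e - 1) = - ln r] explicitly; as [e - 1 < 0], the solution grows beyond any [B] when
    [r] approaches 1. *)
Lemma exists_saddle e (B r : R) : 0 < e < 1 -> 0 < B ->
  expR (- (e * B `^ (e - 1))) < r < 1 ->
  exists2 x, B <= x & r = expR (- (e * x `^ (e - 1))).
Proof.
move=> /andP[e0 e1] B0 /andP[Br r1].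
have r0 : 0 < r by apply: lt_trans Br; exact: expR_gt0.
pose s := - ln r; have s0 : 0 < s by rewrite oppr_gt0 ln_lt0// r0.
have sB : s < e * B `^ (e - 1) by rewrite ltrNl -ltr_expR lnK.
have e1' : 1 - e != 0 by rewrite gt_eqF//; lra.
exists ((e / s) `^ (1 - e)^-1); last first.
  rewrite -powRrM (_ : (1 - e)^-1 * (e - 1) = -1); last by field.
  rewrite powR_inv1; last by rewrite divr_ge0 ?ltW.
  by rewrite invf_div mulrC divfK ?gt_eqF// opprK lnK.
have -> : B = (B `^ (1 - e)) `^ (1 - e)^-1 by rewrite -powRrM mulfV// powRr1// ltW.
apply: ge0_ler_powR; rewrite ?nnegrE ?powR_ge0 ?invr_ge0 ?divr_ge0 ?(ltW s0) ?(ltW e0)//.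
  by lra.
rewrite ler_pdivlMr// -[1 - e]opprB powRN mulrC.
by rewrite ler_pdivrMr ?powR_gt0// ltW.
Qed.

Lemma f_termE e x n : f_term e (expR (- (e * x `^ (e - 1)))) n =
  expR (n%:R `^ e - e * x `^ (e - 1) * n%:R).
Proof. by rewrite /f_term -expRM_natl -expRD mulrN mulrC. Qed.

(** The exponent is concave in [n] with its maximum [(1 - e) x^e] at the saddle point, by the
    tangent inequality there. *)
Lemma f_term_le_saddle e x n : 0 < e < 1 -> 0 < x ->
  f_term e (expR (- (e * x `^ (e - 1)))) n <= expR ((1 - e) * x `^ e).
Proof.
move=> e01 x0; rewrite f_termE ler_expR.
have := powR_le_tangent e01 x0 (ler0n R n).
rewrite -(mulr_powRB1 (ltW x0) (_ : 0 < e)); last by case/andP: e01.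
by lra.
Qed.

(** The width [x^(1 - e/2)] is the one at which the quadratic error [x^e (y/x)^2] reaches 1, so the
    terms lose at most a factor [e^-1] there (Euler's number). *)
Lemma f_term_ge_saddle e x n : 0 < e < 1 -> 0 < x ->
  x <= n%:R <= x + x `^ (1 - e / 2) ->
  expR ((1 - e) * x `^ e - 1) <= f_term e (expR (- (e * x `^ (e - 1)))) n.
Proof.
move=> e01 x0 /andP[xn nx]; rewrite f_termE ler_expR.
have y0 : 0 <= n%:R - x by lra.
have := powR_ge_tangent2 e01 x0 y0; rewrite [x + (_ - x)]addrC subrK.
have : x `^ e * ((n%:R - x) / x) ^+ 2 <= 1.
  apply: (@le_trans _ _ (x `^ e * (x `^ (1 - e / 2) / x) ^+ 2)).
    rewrite ler_wpM2l ?powR_ge0// lerXn2r ?nnegrE ?divr_ge0 ?powR_ge0 ?(ltW x0)//.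
    by rewrite ler_pM2r ?invr_gt0//; lra.
  rewrite -[X in _ / X](powRr1 (ltW x0)) -powRB; last by rewrite (gt_eqF x0) implybT.
  rewrite -powR_mulrn ?powR_ge0// -powRrM -powRD; last by rewrite (gt_eqF x0) implybT.
  by rewrite (_ : e + _ = 0) ?powRr0//; field.
have xe := mulr_powRB1 (ltW x0) (_ : 0 < e).
have {xe} <- := xe ltac:(by case/andP: e01).
by lra.
Qed.

End SaddlePoint.

(** * Comparing the normalizing quantity with sums of terms *)

Section Growth.
Variable R : realType.
Implicit Types (e r x : R).

Lemma modulus_real (x : R) : modulus (x%:C)%C = `|x|.
Proof. by rewrite /modulus /= expr0n addr0 sqrtr_sqr. Qed.

Lemma max_termE e r : max_term (f_coef e) r = sup (range (f_term e r)).
Proof.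
congr (sup _); apply/seteqP; split=> _ [n _ <-]; exists n => //;
  by rewrite /f_coef modulus_real ger0_norm ?expR_ge0.
Qed.

Lemma max_term_le e r B : (forall n, f_term e r n <= B) ->
  max_term (f_coef e) r <= B.
Proof.
move=> H; rewrite max_termE; apply: ge_sup; first by exists (f_term e r 0), 0%N.
by move=> _ [n _ <-].
Qed.

Lemma max_term_ge1 e r B : 0 < e -> (forall n, f_term e r n <= B) ->
  1 <= max_term (f_coef e) r.
Proof.
move=> e0 H; rewrite max_termE; apply: ub_le_sup.
  by exists B => _ [n _ <-].
by exists 0%N => //; rewrite /f_term powR0 ?gt_eqF// expR0 mulr1.
Qed.

Definition growth e r : R :=
  h r * max_term (f_coef e) r * Num.sqrt (ln (h r * max_term (f_coef e) r)).

Lemma growth_ge e T : 0 < e < 1 -> exists2 rho, rho < 1 &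
  forall r, rho < r < 1 -> T <= growth e r.
Proof.
move=> e01; have [e0 _] := andP e01.
pose T' := Num.max T (expR 1).
have T'0 : 0 < T' by rewrite lt_max expR_gt0 orbT.
(* The first bound gives [h r >= T'], hence a logarithm of at least 1 since [T' >= expR 1]; the
   second gives a saddle point, which bounds the terms so that the maximal term is a true
   supremum. *)
exists (Num.max (1 - T'^-1) (expR (- (e * 1 `^ (e - 1))))).
  by rewrite gt_max gtrBl invr_gt0 T'0 powR1 mulr1 -[ltRHS](@expR0 R) ltr_expR oppr_lt0.
move=> r /andP[]; rewrite gt_max => /andP[rT rB] r1.
have [x x1 rE] := exists_saddle e01 ltr01 (introT andP (conj rB r1)).
have x0 : 0 < x by lra.
have m1 : 1 <= max_term (f_coef e) r.
  apply: (@max_term_ge1 _ _ (expR ((1 - e) * x `^ e))) => // n.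
  by rewrite rE f_term_le_saddle.
have hT : T' <= h r.
  rewrite /h -[leLHS]invrK lef_pV2 ?posrE ?invr_gt0 ?subr_gt0//; lra.
have h0 : 0 < h r by apply: lt_le_trans hT.
have hm : h r <= h r * max_term (f_coef e) r by rewrite ler_peMr// ltW.
have Th : T <= h r by apply: le_trans hT; rewrite le_max lexx.
apply: (le_trans Th); apply: (le_trans hm); rewrite /growth.
rewrite ler_peMr//; first by apply: le_trans hm; exact: ltW.
rewrite -[leLHS](@sqrtr1 R) ler_sqrt//.
  by rewrite -[leLHS](@expRK R) ler_ln ?posrE ?expR_gt0 ?(lt_le_trans h0 hm)//
             (le_trans _ hm)// (le_trans _ hT)// le_max lexx orbT.
apply: ln_ge0; apply: le_trans hm; apply: le_trans hT.
by rewrite le_max -[X in X <= expR _](@expR0 R) ler_expR ler01 orbT.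
Qed.

Lemma ln_le_id x : 0 < x -> ln x <= x.
Proof.
move=> x0; have := @le_ln1Dx R (x - 1).
by rewrite addrCA subrr addr0 => /(_ ltac:(lra)); lra.
Qed.

(** Up to constants [h] is at most [x^(1 - e)] and the logarithm at most [x^e], whose square root
    brings the power of [x] to [1 - e/2], the width of the window. *)
Lemma growth_le_saddle e x r : 0 < e < 1 -> 1 <= x -> 2^-1 <= r ->
  r = expR (- (e * x `^ (e - 1))) ->
  growth e r <= 2 / e * Num.sqrt (4 / e) * x `^ (1 - e / 2) * expR ((1 - e) * x `^ e).
Proof.
move=> e01 x1 r2 rE; have [e0 e1] := andP e01.
have x0 : 0 < x by lra.
set s := e * x `^ (e - 1) in rE; have s0 : 0 < s by rewrite mulr_gt0 ?powR_gt0.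
set E := expR _.
have tE n : f_term e r n <= E by rewrite rE f_term_le_saddle.
have m1 := max_term_ge1 e0 tE; have mE := max_term_le tE.
set m := max_term _ r in m1 mE; rewrite /growth -/m.
have r1 : r < 1 by rewrite rE -[ltRHS](@expR0 R) ltr_expR oppr_lt0.
have h_le : h r <= 2 / e * x `^ (1 - e).
  have -> : 2 / e * x `^ (1 - e) = (s / 2)^-1.
    by rewrite /s -[1 - e]opprB powRN; field; rewrite !gt_eqF ?powR_gt0.
  rewrite /h lef_pV2 ?posrE ?subr_gt0 ?divr_gt0//.
  (* Since [expR s >= 1 + s] and [r >= 1/2], this yields [1 - r >= r s >= s / 2]. *)
  have : r * expR s = 1 by rewrite rE expRN mulVf ?gt_eqF ?expR_gt0.
  have := expR_ge1Dx s; nra.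
have h1 : 1 <= h r by rewrite /h invf_ge1 ?subr_gt0//; lra.
set H := 2 / e * _ in h_le *; have H0 : 0 < H by rewrite !mulr_gt0 ?invr_gt0 ?powR_gt0.
have hmHE : h r * m <= H * E by apply: ler_pM => //; lra.
have hm1 : 1 <= h r * m by rewrite -[leLHS]mulr1 ler_pM.
have xe1 : 1 <= x `^ e by have := ler_powR x1 (ltW e0); rewrite powRr0.
have L : ln (h r * m) <= 4 / e * x `^ e.
  apply: (@le_trans _ _ (ln (H * E))).
    have hm0 : 0 < h r * m by exact: lt_le_trans hm1.
    by rewrite ler_ln ?posrE ?hm0// mulr_gt0 ?expR_gt0.
  rewrite !lnM ?posrE ?mulr_gt0 ?expR_gt0 ?invr_gt0 ?powR_gt0//.
  rewrite expRK ln_powR -lnM ?posrE ?invr_gt0//.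
  have le1 : ln (2 / e) <= 2 / e by rewrite ln_le_id ?divr_gt0.
  have le2 : ln x <= x `^ e / e.
    by rewrite ler_pdivlMr// mulrC -ln_powR ln_le_id ?powR_gt0.
  have ei : 1 <= e^-1 by rewrite invf_ge1 ?ltW.
  have le3 : 2 / e <= 2 / e * x `^ e by rewrite ler_peMr// divr_ge0 ?ltW.
  have le4 : (1 - e) * ln x <= (1 - e) * (x `^ e / e) by rewrite ler_wpM2l//; lra.
  have le5 : (1 - e) * (x `^ e / e) <= x `^ e / e.
    by rewrite ler_piMl ?divr_ge0 ?powR_ge0//; lra.
  have le6 : (1 - e) * x `^ e <= x `^ e / e.
    by rewrite mulrC ler_wpM2l ?powR_ge0//; lra.
  have -> : 4 / e * x `^ e = 2 / e * x `^ e + x `^ e / e + x `^ e / e by ring.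
  by lra.
have sL : Num.sqrt (ln (h r * m)) <= Num.sqrt (4 / e) * x `^ (e / 2).
  rewrite powRrM powR12_sqrt ?powR_ge0// -sqrtrM ?divr_ge0 ?(ltW e0)//.
  by rewrite ler_sqrt// mulr_ge0 ?divr_ge0 ?powR_ge0// ltW.
have -> : 2 / e * Num.sqrt (4 / e) * x `^ (1 - e / 2) * E =
          H * E * (Num.sqrt (4 / e) * x `^ (e / 2)).
  rewrite /H (_ : 1 - e / 2 = (1 - e) + e / 2); last by field.
  by rewrite powRD ?(gt_eqF x0) ?implybT//; ring.
by apply: ler_pM => //; apply: le_trans hm1.
Qed.

Lemma window_sum_ge e : 0 < e < 1 -> exists2 c : R, 0 < c & forall N : nat,
  exists2 rho, rho < 1 & forall r, rho < r < 1 -> exists N',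
    c * growth e r <= \sum_(N <= n < N') f_term e r n.
Proof.
move=> e01; have [e0 e1] := andP e01.
pose C2 := 2 / e * Num.sqrt (4 / e).
have C20 : 0 < C2 by rewrite !mulr_gt0 ?sqrtr_gt0 ?invr_gt0 ?divr_gt0.
exists (expR (- 1) / (2 * C2)); first by rewrite divr_gt0 ?expR_gt0// pmulr_rgt0.
(* [x >= N + 4] puts the window beyond [N] and makes its width [w >= sqrt x >= 2], so that it holds
   at least [w - 1 >= w / 2] integers. *)
move=> N; pose B : R := N%:R + 4; have B0 : 0 < B by rewrite ltr_wpDl.
exists (Num.max 2^-1 (expR (- (e * B `^ (e - 1))))).
  rewrite gt_max -[X in _ && (_ < X)](@expR0 R) ltr_expR oppr_lt0 mulr_gt0 ?powR_gt0//.
  by rewrite andbT; lra.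
move=> r /andP[]; rewrite gt_max => /andP[r2 rB] r1.
have [x xB rE] := exists_saddle e01 B0 (introT andP (conj rB r1)).
have N0 : (0 : R) <= N%:R by [].
have x4 : 4 <= x by rewrite /B in xB; lra.
have x0 : 0 < x by lra.
have x1 : 1 <= x by lra.
have r0 : 0 <= r by lra.
have D_le := growth_le_saddle e01 x1 (ltW r2) rE.
rewrite -/C2 in D_le; set w := x `^ (1 - e / 2) in D_le; set E := expR _ in D_le.
have E0 : 0 < E by exact: expR_gt0.
have w2 : 2 <= w.
  apply: (@le_trans _ _ (x `^ 2^-1)); last by rewrite ler_powR//; lra.
  rewrite powR12_sqrt ?(ltW x0)// -[leLHS](@ger0_norm R)// -sqrtr_sqr ler_sqrt ?(ltW x0)//.
  by rewrite expr2; lra.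
have term0 n : 0 <= f_term e r n by rewrite mulr_ge0 ?expR_ge0 ?exprn_ge0.
have /andP[xn0 xn1] := truncn_itv (ltW x0).
have /andP[wk0 wk1] := truncn_itv (powR_ge0 x (1 - e / 2) : 0 <= w).
set n0 := (Num.truncn x).+1 in xn1; set k := Num.truncn w in wk0 wk1.
exists (n0 + k)%N.
have Nn0 : (N <= n0)%N by rewrite -(ler_nat R); rewrite /B in xB; lra.
rewrite (big_cat_nat _ (n := n0))//=; last exact: leq_addr.
apply: ler_wpDl; first exact: sumr_ge0.
apply: (@le_trans _ _ (k%:R * (E * expR (- 1)))).
  apply: (@le_trans _ _ (expR (- 1) / (2 * C2) * (C2 * w * E))).
    by rewrite ler_wpM2l// divr_ge0 ?expR_ge0// mulr_ge0// ltW.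
  have -> : expR (- 1) / (2 * C2) * (C2 * w * E) = (w / 2) * (E * expR (- 1)).
    by field; rewrite gt_eqF.
  rewrite ler_wpM2r ?mulr_ge0 ?expR_ge0//.
  by move: wk1; rewrite -natr1; lra.
have -> : k%:R * (E * expR (- 1)) = \sum_(n0 <= n < n0 + k) (E * expR (- 1)).
  by rewrite sumr_const_nat addKn mulr_natl.
apply: ler_sum_nat => n /andP[n1 n2]; rewrite -expRD rE f_term_ge_saddle//.
apply/andP; split; first by apply: (le_trans (ltW xn1)); rewrite ler_nat.
rewrite -/w; have : (n.+1%:R : R) <= n0%:R + k%:R by rewrite -natrD ler_nat.
by rewrite -[n.+1%:R]natr1 -[n0%:R]natr1; lra.
Qed.

End Growth.

(** * Dominated complex series through their real and imaginary parts *)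

Section ComplexSeries.
Variable R : realType.
Local Open Scope complex_scope.

Lemma modulus_ge_Re (z : R[i]) : `|complex.Re z| <= modulus z.
Proof.
case: z => a b; rewrite /modulus /= -sqrtr_sqr ler_sqrt ?lerDl ?sqr_ge0//.
by rewrite addr_ge0 ?sqr_ge0.
Qed.

Lemma modulus_ge_Im (z : R[i]) : `|complex.Im z| <= modulus z.
Proof.
case: z => a b; rewrite /modulus /= -sqrtr_sqr ler_sqrt ?lerDr ?sqr_ge0//.
by rewrite addr_ge0 ?sqr_ge0.
Qed.

Lemma modulus_le_ReIm (a b : R) : modulus (a +i* b) <= `|a| + `|b|.
Proof.
rewrite /modulus /= -[leRHS]ger0_norm ?addr_ge0// -sqrtr_sqr ler_sqrt ?sqr_ge0//.
rewrite sqrrD -!normrX !(ger0_norm (sqr_ge0 _)) addrAC lerDl.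
by rewrite mulrn_wge0 ?mulr_ge0.
Qed.

Lemma cvg_complex (x y : nat -> R) (a b : R) :
  x @ \oo --> a -> y @ \oo --> b ->
  (fun n => x n +i* y n : R[i]^o) @ \oo --> (a +i* b : R[i]^o).
Proof.
move=> xa yb; apply/cvgrPdist_lt => eps eps0.
(* The radius is an element of [R[i]]; in the order there, positivity forces it to be real. *)
have [e0 epsE] : 0 < complex.Re eps /\ eps = (complex.Re eps)%:C.
  by move: eps0; case: eps => u v; rewrite ltcE /= => /andP[/eqP -> ->].
have e2 : 0 < complex.Re eps / 2 by rewrite divr_gt0.
move/cvgrPdist_lt : xa => /(_ _ e2) xa; move/cvgrPdist_lt : yb => /(_ _ e2) yb.
near=> n; rewrite epsE.
have -> : `|(a +i* b) - (x n +i* y n)| = (modulus ((a - x n) +i* (b - y n)))%:C.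
  by [].
rewrite ltcR; apply: le_lt_trans (modulus_le_ReIm _ _) _.
rewrite [ltRHS]splitr; apply: ltrD; first by near: n.
by near: n.
Unshelve. all: by end_near. Qed.

Lemma Re_sum (u : nat -> R[i]) n :
  complex.Re (\sum_(0 <= k < n) u k) = \sum_(0 <= k < n) complex.Re (u k).
Proof. by rewrite raddf_sum. Qed.

Lemma Im_sum (u : nat -> R[i]) n :
  complex.Im (\sum_(0 <= k < n) u k) = \sum_(0 <= k < n) complex.Im (u k).
Proof. by rewrite raddf_sum. Qed.

Lemma dominated_series_cvg (u v : nat -> R) :
  (forall n, `|u n| <= v n) -> cvgn (series v) -> cvgn (series u).
Proof.
move=> uv cv; apply: normed_cvg; apply: series_le_cvg cv => //.
  by move=> n; exact: normr_ge0.
by move=> n; apply: le_trans (uv n).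
Qed.

Lemma dominated_complex_series (u : nat -> R[i]) (v : nat -> R) :
  (forall n, modulus (u n) <= v n) -> cvgn (series v) ->
  limn (series u : nat -> R[i]^o) =
    limn (series (fun n => complex.Re (u n))) +i*
    limn (series (fun n => complex.Im (u n))).
Proof.
move=> uv cv; apply: cvg_lim; first exact: norm_hausdorff.
have cR : cvgn (series (fun n => complex.Re (u n))).
  by apply: dominated_series_cvg cv => n; apply: le_trans (uv n); exact: modulus_ge_Re.
have cI : cvgn (series (fun n => complex.Im (u n))).
  by apply: dominated_series_cvg cv => n; apply: le_trans (uv n); exact: modulus_ge_Im.
rewrite (_ : series u = fun n => series (fun n => complex.Re (u n)) n +i*
   series (fun n => complex.Im (u n)) n); first exact: cvg_complex.
apply/funext => n; rewrite /series /= -Re_sum -Im_sum.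
by case: (\sum_(_ <= _ < _) _).
Qed.

Lemma norm_lim_series_le (u v : nat -> R) :
  (forall n, `|u n| <= v n) -> cvgn (series v) ->
  `|limn (series u)| <= limn (series v).
Proof.
move=> uv cv; have cu := dominated_series_cvg uv cv.
have part n : `|series u n| <= limn (series v).
  apply: (@le_trans _ _ (series v n)).
    by apply: le_trans (ler_norm_sum _ _ _) _; exact: ler_sum.
  apply: nondecreasing_cvgn_le cv n => a b ab.
  by rewrite -subr_ge0 sub_series_geq//; apply: sumr_ge0 => i _; apply: le_trans (uv i).
rewrite ler_norml; apply/andP; split.
  by apply: limr_ge => //; apply: nearW => n; have := part n; rewrite ler_norml => /andP[].
by apply: limr_le => //; apply: nearW => n; have := part n; rewrite ler_norml => /andP[].
Qed.

End ComplexSeries.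

(** * Lower bounds for the maximum modulus *)

Section MaxModulus.
Variable R : realType.
Implicit Types (e r t : R) (theta : nat -> nat).

Lemma f_term_ge0 e r n : 0 <= r -> 0 <= f_term e r n.
Proof. by move=> r0; rewrite mulr_ge0 ?expR_ge0 ?exprn_ge0. Qed.

Lemma modulus_expi (x : R) : modulus (expi x) = 1.
Proof. by rewrite /modulus /= cos2Dsin2 sqrtr1. Qed.

Lemma modulusM (z w : R[i]) : modulus (z * w) = modulus z * modulus w.
Proof. exact: Normc.normcM. Qed.

Lemma modulusX (z : R[i]) n : modulus (z ^+ n) = modulus z ^+ n.
Proof.
elim: n => [|n IH]; first exact: Normc.normc1.
by rewrite !exprS modulusM IH.
Qed.

Lemma modulus_ft_coefX theta e t (z : R[i]) n :
  modulus (ft_coef theta e t n * z ^+ n) = f_term e (modulus z) n.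
Proof.
rewrite /ft_coef !modulusM modulus_expi mulr1 modulusX.
by rewrite /f_coef modulus_real ger0_norm ?expR_ge0.
Qed.

(** The tangent of slope [s = - ln r / 2] bounds [n^e] by [x^e + s n]; half of the decay of [r ^+ n]
    is left and gives a geometric majorant. *)
Lemma cvg_series_f_term e r : 0 < e < 1 -> 0 < r < 1 -> cvgn (series (f_term e r)).
Proof.
move=> e01 /andP[r0 r1]; have [e0 e1] := andP e01.
pose s := - ln r / 2; have s0 : 0 < s by rewrite divr_gt0// oppr_gt0 ln_lt0// r0.
have e1' : e - 1 != 0 by rewrite lt_eqF//; lra.
pose x := (s / e) `^ (e - 1)^-1.
have x0 : 0 < x by apply: powR_gt0; exact: divr_gt0.
have xs : e * x `^ (e - 1) = s.
  rewrite /x -powRrM mulVf// powRr1; last by rewrite ltW// divr_gt0.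
  by rewrite mulrC divfK ?gt_eqF.
have rE : r = expR (- s) * expR (- s).
  by rewrite -expRD /s (_ : _ + _ = ln r) ?lnK//; field.
apply: (@series_le_cvg _ _ (geometric (expR (x `^ e)) (expR (- s)))).
- by move=> n; apply/f_term_ge0/ltW.
- by move=> n; rewrite /geometric /= mulr_ge0 ?expR_ge0// exprn_ge0 ?expR_ge0.
- move=> n; rewrite /geometric /= /f_term {1}rE exprMn -expRM_natl -!expRD ler_expR.
  have := powR_le_tangent e01 x0 (ler0n R n); rewrite xs.
  have : 0 <= s * x by rewrite mulr_ge0// ltW.
  by lra.
- apply: is_cvg_geometric_series; rewrite ger0_norm ?expR_ge0//.
  by rewrite -[ltRHS](@expR0 R) ltr_expR oppr_lt0.
Qed.

Lemma f_tE theta e t (z : R[i]) : 0 < e < 1 -> 0 < modulus z < 1 ->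
  f_t theta e t z = (
    limn (series (fun n => complex.Re (ft_coef theta e t n * z ^+ n))) +i*
    limn (series (fun n => complex.Im (ft_coef theta e t n * z ^+ n))))%C.
Proof.
move=> e01 z01; apply: dominated_complex_series (cvg_series_f_term e01 z01) => n.
by rewrite modulus_ft_coefX.
Qed.

Lemma max_modulus_f_t_ge theta e t r : 0 < e < 1 -> 0 < r < 1 ->
  limn (series (fun n => f_term e r n * cos ((theta n)%:R * t))) <=
  max_modulus (f_t theta e t) r.
Proof.
move=> e01 r01; have [r0 r1] := andP r01; have ct := cvg_series_f_term e01 r01.
have mr : modulus (r%:C)%C = r by rewrite modulus_real gtr0_norm.
apply: (@le_trans _ _ (modulus (f_t theta e t (r%:C)%C))).
  apply: le_trans (modulus_ge_Re _); apply: le_trans (ler_norm _).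
  rewrite f_tE ?mr//= le_eqVlt; apply/orP; left; apply/eqP.
  congr (limn _); congr (series _); apply/funext => n.
  rewrite /ft_coef /f_coef /expi -rmorphXn /= /f_term.
  by ring.
apply: ub_le_sup; last by exists (r%:C)%C.
(* An upper bound on the circle is required, as [sup] of an unbounded set is a default value. *)
exists (limn (series (f_term e r)) + limn (series (f_term e r))) => _ [z /= zr <-].
have z01 : 0 < modulus z < 1 by rewrite zr.
rewrite f_tE//; apply: le_trans (modulus_le_ReIm _ _) _.
by apply: lerD; apply: norm_lim_series_le => // n;
  rewrite -zr -(modulus_ft_coefX theta e t) ?modulus_ge_Re ?modulus_ge_Im.
Qed.

(** The head is bounded because [r < 1], the tail by the Cauchy criterion. [N'] is chosen before
    [t], so the bound is one finite cosine sum, continuous in [t]. *)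
Lemma max_modulus_f_t_ge_window theta e r (N N0 : nat) :
  0 < e < 1 -> 0 < r < 1 -> exists2 N', (N0 <= N')%N & forall t,
  \sum_(N <= n < N') f_term e r n * cos ((theta n)%:R * t) -
  \sum_(0 <= n < N) expR (n%:R `^ e) - 1 <= max_modulus (f_t theta e t) r.
Proof.
move=> e01 r01; have [r0 r1] := andP r01; have ct := cvg_series_f_term e01 r01.
have t0 n : 0 <= f_term e r n by apply/f_term_ge0/ltW.
set v := fun n => f_term e r n.
have [N1 N1P] : exists N1, forall a b, (N1 <= a)%N -> (a <= b)%N ->
    \sum_(a <= n < b) v n <= 1.
  move/cauchy_cvgP/cauchy_seriesP : ct => /(_ _ ltr01)[[A B] /= [[a _ aA] [b _ bB]] AB].
  exists (maxn a b) => i j Ni ij.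
  have := AB (i, j); rewrite /= => H.
  apply: le_trans (ler_norm _) (ltW (H _)); split => /=.
    by apply: aA => /=; lia.
  by apply: bB => /=; lia.
exists (maxn N (maxn N0 N1)); first by lia.
move=> t; set N' := maxn _ _; apply: le_trans (max_modulus_f_t_ge theta t e01 r01).
pose u n := f_term e r n * cos ((theta n)%:R * t).
rewrite -[\sum_(N <= n < N') _]/(\sum_(N <= n < N') u n) -/u.
have uv n : `|u n| <= v n.
  by rewrite /u normrM ger0_norm// ler_piMr// cos_max.
apply: limr_ge; first exact: dominated_series_cvg uv ct.
exists N' => // M /= N'M; rewrite /series /=.
rewrite (@big_cat_nat _ _ _ N' 0%N M)//= (@big_cat_nat _ _ _ N 0%N N')//=; last by lia.
have hd : - \sum_(0 <= n < N) expR (n%:R `^ e) <= \sum_(0 <= n < N) u n.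
  rewrite -sumrN; apply: ler_sum => n _; rewrite lerNl.
  apply: le_trans (ler_norm _) _; rewrite normrN; apply: le_trans (uv n) _.
  by rewrite /v /f_term ler_piMr ?expR_ge0// exprn_ile1 ?ltW.
have tl : - 1 <= \sum_(N' <= n < M) u n.
  rewrite lerNl; apply: le_trans (ler_norm _) _; rewrite normrN.
  apply: le_trans (ler_norm_sum _ _ _) _; apply: le_trans (N1P N' M _ N'M).
    by apply: ler_sum.
  by rewrite /N'; lia.
by lra.
Qed.

End MaxModulus.

(** * From growth near every point to nowhere density *)

Section Category.
Variable R : realType.

Lemma limn_esup_lt_near (u : nat -> \bar R) (B : \bar R) :
  (limn_esup u < B)%E -> exists k, forall n, (k <= n)%N -> (u n < B)%E.
Proof.
rewrite /limn_esup limf_esupE => /ereal_inf_lt[_ [A [k _ kA] <-] AB].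
exists k => n kn; apply: le_lt_trans AB; apply: ereal_sup_ubound.
by exists n => //; exact: kA.
Qed.

Lemma continuous_sum (F : nat -> R -> R) (m n : nat) :
  (forall i, continuous (F i)) -> continuous (fun t => \sum_(m <= i < n) F i t).
Proof.
move=> cF; elim: (index_iota m n) => [|i s IH].
  have -> : (fun t => \sum_(j <- [::]) F j t) = fun=> 0.
    by apply/funext => t; rewrite big_nil.
  by move=> t; exact: cvg_cst.
have -> : (fun t => \sum_(j <- i :: s) F j t) =
    fun t => F i t + \sum_(j <- s) F j t.
  by apply/funext => t; rewrite big_cons.
by move=> t; apply: cvgD; [exact: cF|exact: IH].
Qed.

(** If the closure of [A] contained a ball, the Sidon property would give a point [t] of it with a
    large cosine sum, and continuity a point of [A] with nearly the same sum, against the slow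
    growth on [A]. *)
Lemma nowhere_dense_slow_growth (theta : nat -> nat) (e c1 c2 : R)
    (r : nat -> R) (A : set R) (k : nat) :
  0 < e < 1 -> 0 < c1 -> 0 < c2 ->
  (forall t0 eta, 0 < eta -> exists N, forall (a : nat -> R) N',
    (forall n, 0 <= a n) -> exists2 t, `|t - t0| < eta &
      c1 * \sum_(N <= n < N') a n <=
      \sum_(N <= n < N') a n * cos ((theta n)%:R * t)) ->
  (forall N : nat, exists2 rho, rho < 1 & forall r, rho < r < 1 ->
    exists N', c2 * growth e r <= \sum_(N <= n < N') f_term e r n) ->
  (forall n : nat, 0 < r n < 1) -> r @ \oo --> (1 : R) ->
  (forall t n, A t -> (k <= n)%N -> 0 < growth e (r n) ->
    max_modulus (f_t theta e t) (r n) <= c1 * c2 / 2 * growth e (r n)) ->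
  nowhere_dense A.
Proof.
move=> e01 c10 c20 sidon window r01 r1 slow.
apply/seteqP; split=> // t0 /= [eta /= eta0 ballA].
have [N NP] := sidon t0 eta eta0.
have [rho1 rho1_lt window_N] := window N.
pose S0 : R := \sum_(0 <= n < N) expR (n%:R `^ e).
(* Half of [c1 * c2 * growth] must exceed the total loss [S0 + 2]: the head [S0], 1 for the tail and
   1 for moving from [t] to [t']. The maximum with 1 keeps [growth] positive. *)
pose T := Num.max 1 (2 / (c1 * c2) * (S0 + 3)).
have [rho2 rho2_lt growthT] := growth_ge T e01.
have [n kn rn] : exists2 n, (k <= n)%N & Num.max rho1 rho2 < r n.
  have rho_lt : Num.max rho1 rho2 < 1 by rewrite gt_max rho1_lt.
  have [n0 _ n0P] := cvgr_gt _ r1 _ rho_lt.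
  by exists (maxn k n0); [lia|apply: n0P => /=; lia].
move: rn; rewrite gt_max => /andP[rn1 rn2]; have [rn0 rn_lt1] := andP (r01 n).
have GT := growthT (r n) (introT andP (conj rn2 rn_lt1)).
have [N1 N1P] := window_N (r n) (introT andP (conj rn1 rn_lt1)).
have [N' N1N' N'P] := max_modulus_f_t_ge_window theta N N1 e01 (r01 n).
pose a i := f_term e (r n) i.
have a0 i : 0 <= a i by apply/f_term_ge0/ltW.
have [t tt0 tP] := NP a N' a0.
pose S y := \sum_(N <= i < N') a i * cos ((theta i)%:R * y).
have cS : continuous S.
  apply: continuous_sum => i y; apply: cvgM; first exact: cvg_cst.
  apply: continuous_comp; last exact: continuous_cos.
  by apply: cvgM; [exact: cvg_cst|exact: cvg_id].
have near_t : nbhs t [set y | S t - 1 < S y].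
  by apply: (cvgr_gt _ (cS t)); lra.
have [t' [At' St']] := ballA t ltac:(by rewrite /= /ball /= distrC) _ near_t.
have G0 : 0 < growth e (r n) by apply: lt_le_trans GT; rewrite lt_max ltr01.
have := slow t' n At' kn G0; have := N'P t'; rewrite -/S0 -/(S t').
have window_le : c2 * growth e (r n) <= \sum_(N <= i < N') a i.
  apply: (le_trans N1P); have [NN1|N1N] := leqP N N1.
    rewrite [leRHS](@big_cat_nat _ _ _ N1)//= ler_wpDr//; exact: sumr_ge0.
  by rewrite big_geq ?(ltnW N1N)//; exact: sumr_ge0.
have c120 : 0 < c1 * c2 by rewrite mulr_gt0.
have St_ge : c1 * c2 * growth e (r n) <= S t.
  by apply: le_trans tP; rewrite -mulrA ler_pM2l.
have GT' : S0 + 3 <= c1 * c2 / 2 * growth e (r n).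
  have -> : S0 + 3 = c1 * c2 / 2 * (2 / (c1 * c2) * (S0 + 3)).
    by field; rewrite !gt_eqF.
  rewrite ler_pM2l ?divr_gt0//.
  by apply: le_trans GT; rewrite le_max lexx orbT.
rewrite /= in St'.
by lra.
Qed.

End Category.

(** * The constant and the decomposition of the exceptional set *)

Theorem theorem4p1 (R : realType) (theta : nat -> nat)
  (theta_gt0 : forall n : nat, (0 < theta n)%N)
  (theta_lacunary : exists q : R, 1 < q /\
     forall n : nat, q <= (theta n.+1)%:R / (theta n)%:R)
  (eps : R) (eps01 : 0 < eps < 1) :
  exists C : R, 0 < C /\
    forall r : nat -> R,
      (forall n : nat, 0 < r n < 1) ->
      nondecreasing_seq r ->
      r @ \oo --> (1 : R) ->
      first_category
        [set t : R |
          (limn_esup (fun n : nat =>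
             (max_modulus (f_t theta eps t) (r n) /
              (h (r n) * max_term (f_coef eps) (r n) *
               Num.sqrt (ln (h (r n) * max_term (f_coef eps) (r n)))))%:E)
           <= C%:E)%E].
Proof.
have [c1 c10 sidon] := lacunary_local_sidon theta_gt0 theta_lacunary.
have [c2 c20 window] := window_sum_ge eps01.
(* Strictly below [c1 * c2 / 2], so an upper limit of at most [C] makes the ratios smaller than
   [c1 * c2 / 2] from some rank on. *)
pose C := c1 * c2 / 4.
have C0 : 0 < C by rewrite divr_gt0// mulr_gt0.
exists C; split=> // r r01 _ r1.
set A := [set t | _].
(* Intersecting with [A] makes the union equal to [A], as [first_category] demands. *)
pose F k := A `&` [set t | forall n, (k <= n)%N ->
  max_modulus (f_t theta eps t) (r n) / growth eps (r n) < c1 * c2 / 2].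
exists F.
  move=> k; apply: (nowhere_dense_slow_growth (k := k) eps01 c10 c20 sidon window r01 r1).
  by move=> t n [_ H] kn G0; have := H n kn; rewrite ltr_pdivrMr// => /ltW.
apply/seteqP; split=> [t At|t [k _ []]//].
have /limn_esup_lt_near[k kP] : (limn_esup (fun n =>
    (max_modulus (f_t theta eps t) (r n) / growth eps (r n))%:E) < (c1 * c2 / 2)%:E)%E.
  by apply: le_lt_trans At _; rewrite lte_fin; move: C0; rewrite /C; lra.
by exists k => //; split=> // n /kP; rewrite lte_fin.
Qed.
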